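(* Let $m,n\ge 1$ be integers. The number of monomer-dimer tilings of the $m\times n$ grid is odd if and only if the polynomials $p_m(\lambda)$ and $p_n(1+\lambda)$ are relatively prime modulo 2, i.e. relatively prime in $\mathbb{F}_2[\lambda]$.
   Context: A monomer-dimer tiling of the $m\times n$ grid is a partition of the $mn$ unit cells of the grid into monomers (single cells) and dimers (pairs of cells sharing a side, horizontal or vertical). Equivalently, it is a set of edges of the $m\times n$ orthogonal grid graph with a loop added at every vertex such that every vertex is incident to exactly one chosen edge (loops being monomers and non-loop edges being dimers). The binary Chebyshev polynomials $p_m(\lambda)$, with coefficients taken modulo 2, are defined by $p_0(\lambda)=1$, $p_1(\lambda)=\lambda$, and $p_m(\lambda)=\lambda p_{m-1}(\lambda)+p_{m-2}(\lambda)$ for $m\ge 2$. *)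

(* Defs.v *)
From mathcomp Require Import all_boot all_algebra.

Set Implicit Arguments.
Unset Strict Implicit.
Unset Printing Implicit Defensive.

Import GRing.Theory.

Definition adjacent (m n : nat) (u v : 'I_m * 'I_n) : bool :=
  (u.1 == v.1) && ((u.2.+1 == v.2 :> nat) || (v.2.+1 == u.2 :> nat))
  || (u.2 == v.2) && ((u.1.+1 == v.1 :> nat) || (v.1.+1 == u.1 :> nat)).

Definition is_monomer (m n : nat) (B : {set 'I_m * 'I_n}) : bool :=
  [exists u, B == [set u]].

Definition is_dimer (m n : nat) (B : {set 'I_m * 'I_n}) : bool :=
  [exists u, exists v, adjacent u v && (B == [set u; v])].

Definition monomer_dimer_tilings (m n : nat) : {set {set {set 'I_m * 'I_n}}} :=
  [set P : {set {set 'I_m * 'I_n}} |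
     partition P [set: 'I_m * 'I_n]
     & [forall B in P, is_monomer B || is_dimer B]].

Local Open Scope ring_scope.

Fixpoint binary_chebyshev (m : nat) : {poly 'F_2} :=
  match m with
  | 0 => 1
  | 1 => 'X
  | (k.+1 as l).+1 => 'X * binary_chebyshev l + binary_chebyshev k
  end.

(* Main.v *)
(* Tilings of the grid are the involutions of the cells that move each cell to itself or to a
   neighbour. Modulo 2 their number is the determinant of 1 + P_m (x) 1 + 1 (x) P_n, with P_k the
   adjacency matrix of the path on k vertices: in the Leibniz formula the terms of s and s^-1
   cancel. The kernel of this matrix is the space of X with P_m X = X (1 + P_n). Such an X is
   determined by its first row x, its i-th row being x p_i(1 + P_n), and the only constraint is
   x p_m(1 + P_n) = 0; so the determinant is nonzero iff p_m(1 + P_n) is invertible. As p_n is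
   the minimal polynomial of P_n, this holds iff p_m(1 + 'X) and p_n are coprime;
   now substitute 1 + 'X for 'X. *)

Require Import Defs.
From mathcomp Require Import all_boot all_fingroup all_algebra.
From mathcomp Require Import zify.

Set Implicit Arguments.
Unset Strict Implicit.
Unset Printing Implicit Defensive.

Import GRing.Theory.
Local Open Scope ring_scope.

(** * Arithmetic over ['F_2] and sums invariant under an involution *)

Lemma oppr_F2 (V : lmodType 'F_2) (x : V) : - x = x.
Proof. by rewrite -scaleN1r (_ : -1 = 1 :> 'F_2) ?scale1r //; apply/val_inj. Qed.

Lemma addrr_F2 (V : lmodType 'F_2) (x : V) : x + x = 0.
Proof. by rewrite -{2}[x]oppr_F2 subrr. Qed.

Lemma natr_F2_neq0 (k : nat) : (k%:R != 0 :> 'F_2) = odd k.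
Proof. by rewrite -val_eqE /= val_Fp_nat // modn2; case: (odd k). Qed.

(** The points moved by [f] form pairs with equal values of [F], which cancel modulo 2. *)
Lemma sum_involution (T : finType) (f : T -> T) (F : T -> 'F_2) :
  involutive f -> (forall x, F (f x) = F x) -> \sum_x F x = \sum_(x | f x == x) F x.
Proof.
move=> fK Ff; rewrite (bigID (fun x => f x == x)) /=.
rewrite [X in _ + X](_ : _ = 0) ?addr0 //.
(* Comparing the ranks of [x] and [f x] splits the moved points into two halves, exchanged by
   [f]. *)
rewrite (bigID (fun x => enum_rank x < enum_rank (f x))%N) /=.
rewrite [X in _ + X](reindex_inj (inv_inj fK)) /=.
rewrite (eq_bigr _ (fun x _ => Ff x)).
rewrite [X in _ + X](eq_bigl (fun x => (f x != x) && (enum_rank x < enum_rank (f x))%N)).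
  exact/addrr_pchar2/pchar_Fp.
move=> x; rewrite fK [x == _]eq_sym -leqNgt; case: eqP => //= /eqP fx.
by rewrite ltn_neqAle val_eqE (inj_eq enum_rank_inj) eq_sym fx.
Qed.

Lemma perm_fixed_involutive (T : finType) (s : {perm T}) :
  (s^-1%g == s) -> involutive s.
Proof. by move/eqP=> sV x; rewrite -{1}sV permK. Qed.

(** * Partitions into related pairs and the determinant of a symmetric relation *)

Section PairPartitions.
Variables (T : finType) (r : rel T).
Hypothesis r_sym : symmetric r.

Definition rel_mx : 'M['F_2]_#|T| := \matrix_(i, j) (r (enum_val i) (enum_val j))%:R.

Definition enum_perm (s : {perm T}) : 'S_#|T| :=
  perm (inj_comp enum_rank_inj (inj_comp (@perm_inj _ s) enum_val_inj)).

Lemma enum_perm_bij : bijective enum_perm.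
Proof.
apply: inj_card_bij; last by rewrite card_Sn -cardsT -card_perm max_card.
move=> s t st; apply/permP=> x; apply: enum_rank_inj.
by have /permP/(_ (enum_rank x)) := st; rewrite !permE /= enum_rankK.
Qed.

(** Signs disappear modulo 2, so the Leibniz term of [s] is the indicator of [r x (s x)] for all
    [x]. As [r] is symmetric, [s] and its inverse have equal terms, and [sum_involution] applies. *)
Lemma det_rel_mx :
  \det rel_mx =
    #|[set s : {perm T} | (s^-1%g == s) && [forall x, r x (s x)]]|%:R.
Proof.
rewrite /determinant (reindex enum_perm) /=; last exact: onW_bij enum_perm_bij.
pose F (s : {perm T}) : 'F_2 := [forall x, r x (s x)]%:R.
transitivity (\sum_s F s).
  apply: eq_bigr => s _; rewrite (_ : -1 = 1 :> 'F_2) ?expr1n ?mul1r; last exact: val_inj.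
  rewrite (reindex (@enum_rank T)) /=; last exact/onW_bij/enum_rank_bij.
  under eq_bigr => x _ do rewrite mxE permE /= !enum_rankK.
  rewrite /F; case: forallP => [rs|nrs]; first by rewrite big1 // => x _; rewrite rs.
  have /existsP [x /negPf rx] : [exists x, ~~ r x (s x)].
    by rewrite -negb_forall; apply/forallP.
  by rewrite (bigD1 x) //= rx mul0r.
rewrite (sum_involution (f := fun s => s^-1)%g) => [|s|s].
- rewrite /F (eq_bigr (fun s : {perm T} => if [forall x, r x (s x)] then 1 else 0)).
    by rewrite -big_mkcondr /= sumr_const; congr (_%:R); apply: eq_card => s; rewrite !inE.
  by move=> s _; case: ifP.
- exact: invgK.
- rewrite /F; congr (nat_of_bool _)%:R; apply/idP/idP => /forallP rs; apply/forallP=> x.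
    by have := rs (s x); rewrite permK r_sym.
  by have := rs (s^-1%g x); rewrite permKV r_sym.
Qed.

(** For an involution [s] these are the orbits, a fixed point giving a singleton. *)
Definition orbit_pairs (s : {perm T}) : {set {set T}} := [set [set x; s x] | x : T].

(** The block of [x] determines [s x]: it is the other element, or [x] itself in a singleton. *)
Lemma orbit_pairs_inj :
  {in [pred s : {perm T} | s^-1%g == s] &, injective orbit_pairs}.
Proof.
move=> s t /perm_fixed_involutive sK /perm_fixed_involutive tK st.
apply/permP=> x.
have : [set x; s x] \in orbit_pairs t by rewrite -st; apply/imsetP; exists x.
case/imsetP=> y _ /setP E.
have := E x; rewrite !inE eqxx /= => /esym/orP xy.
have {}E z : (z \in [set x; s x]) = (z \in [set x; t x]).
  by rewrite E !inE; case: xy => /eqP -> //; rewrite tK orbC.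
have := E (s x); rewrite !inE eqxx orbT => /esym/orP [/eqP sx|/eqP //].
by have := E (t x); rewrite !inE eqxx orbT sx orbb => /eqP.
Qed.

Definition pair_blocks (P : {set {set T}}) : bool :=
  [forall B in P, [exists x, exists y, r x y && (B == [set x; y])]].

Lemma orbit_pairs_partition (s : {perm T}) :
  s^-1%g == s -> [forall x, r x (s x)] ->
  partition (orbit_pairs s) [set: T] && pair_blocks (orbit_pairs s).
Proof.
move/perm_fixed_involutive=> sK /forallP rs; apply/andP; split; last first.
  apply/forall_inP=> B /imsetP [x _ ->].
  by apply/existsP; exists x; apply/existsP; exists (s x); rewrite rs eqxx.
apply/and3P; split.
- apply/eqP/setP=> x; rewrite inE; apply/bigcupP; exists [set x; s x].
    by apply/imsetP; exists x.
  by rewrite !inE eqxx.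
- apply/trivIsetP=> A B /imsetP [x _ ->] /imsetP [y _ ->]; apply: contraNT.
  case/pred0Pn=> z /=; rewrite !inE => /andP [zx zy].
  have pair w : (z == w) || (z == s w) -> [set w; s w] = [set z; s z].
    by case/orP=> /eqP -> //; rewrite sK setUC.
  by rewrite (pair x) // (pair y).
- apply/imsetP=> -[x _ /setP /(_ x)]; rewrite !inE eqxx //.
Qed.

(** The permutation exchanges the elements of each two-element block and fixes the singletons. *)
Lemma partition_orbit_pairs (P : {set {set T}}) :
  partition P [set: T] -> pair_blocks P ->
  exists s : {perm T}, [&& s^-1%g == s, [forall x, r x (s x)] & P == orbit_pairs s].
Proof.
move=> /[dup] Ppart /and3P [/eqP coverP trivP nP] /forall_inP pairP.
have blockP x : exists y, r x y && (pblock P x == [set x; y]).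
  have xP : x \in cover P by rewrite coverP.
  have /existsP [a /existsP [b /andP [rab /eqP Pab]]] := pairP _ (pblock_mem xP).
  have := mem_pblock P x; rewrite xP Pab !inE => /orP [] /eqP ->.
    by exists b; rewrite rab eqxx.
  by exists a; rewrite r_sym rab setUC eqxx.
pose f x := xchoose (blockP x).
have fP x : r x (f x) /\ pblock P x = [set x; f x].
  by have /andP [? /eqP] := xchooseP (blockP x).
have fK : involutive f.
  move=> x; have fx : f x \in pblock P x by rewrite (fP x).2 !inE eqxx orbT.
  (* Since [x] and [f x] share a block, [x] is [f x] or [f (f x)]; either way [f (f x) = x]. *)
  have := same_pblock trivP fx; rewrite (fP x).2 (fP (f x)).2 => /setP E.
  have := E x; rewrite !inE eqxx /= => /orP [/eqP xf|/eqP //].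
  by rewrite -xf -xf.
exists (perm (inv_inj fK)); apply/and3P; split.
- by apply/eqP/permP=> x; apply: (@perm_inj _ (perm (inv_inj fK))); rewrite permKV !permE fK.
- by apply/forallP=> x; rewrite permE; case: (fP x).
apply/eqP/setP=> B; apply/idP/imsetP=> [BP|[x _ ->]]; last first.
  by rewrite permE -(fP x).2 pblock_mem // coverP.
have /set0Pn [x xB] := partition_neq0 Ppart BP.
by exists x => //; rewrite permE -(fP x).2 (def_pblock trivP BP xB).
Qed.

Lemma odd_pair_partitions :
  odd #|[set P : {set {set T}} | partition P [set: T] && pair_blocks P]| =
    (\det rel_mx != 0).
Proof.
rewrite det_rel_mx natr_F2_neq0; congr odd.
rewrite -[RHS](card_in_imset (f := orbit_pairs)); last first.
  move=> s t; rewrite !inE => /andP [sV _] /andP [tV _].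
  exact: orbit_pairs_inj.
apply: eq_card => P; rewrite inE; apply/andP/imsetP => [[]|[s]].
  move=> /partition_orbit_pairs /[apply] -[s /and3P [sV rs /eqP ->]].
  by exists s; rewrite // inE sV rs.
by rewrite inE => /andP [sV rs] ->; apply/andP/orbit_pairs_partition.
Qed.

(** The left kernel is expressed by functions on [T], which removes the enumeration of [T] from the
    later arguments. *)
Lemma det_rel_mx_neq0P :
  reflect (forall f : T -> 'F_2,
             (forall y, \sum_x f x * (r x y)%:R = 0) -> forall x, f x = 0)
    (\det rel_mx != 0).
Proof.
apply: (iffP idP) => [|H].
  move=> /det0P dN f fr x; apply/eqP/negPn/negP => fx; case: dN.
  exists (\row_i f (enum_val i)).
    by apply: contraNneq fx => /rowP /(_ (enum_rank x)); rewrite !mxE enum_rankK => ->.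
  apply/rowP=> j; rewrite !mxE -[RHS](fr (enum_val j)).
  rewrite [RHS](reindex (@enum_val _ T)) /=; last exact/onW_bij/enum_val_bij.
  by apply: eq_bigr => i _; rewrite !mxE.
apply/negP=> /det0P [v /eqP v0 vr]; apply: v0; apply/rowP=> i; rewrite mxE.
rewrite -[i]enum_valK; apply: (H (fun x => v 0 (enum_rank x))) => y.
have /rowP /(_ (enum_rank y)) := vr; rewrite !mxE => vy; rewrite -[RHS]vy.
rewrite (reindex (@enum_rank T)) /=; last exact/onW_bij/enum_rank_bij.
by apply: eq_bigr => x _; rewrite !mxE !enum_rankK.
Qed.
End PairPartitions.

(** * Binary Chebyshev polynomials and the shift by 1 *)

Local Arguments binary_chebyshev : simpl never.

Lemma binary_chebyshevSS (k : nat) :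
  binary_chebyshev k.+2 = 'X * binary_chebyshev k.+1 + binary_chebyshev k.
Proof. by []. Qed.

Lemma size_binary_chebyshev (k : nat) : size (binary_chebyshev k) = k.+1.
Proof.
have [//] : size (binary_chebyshev k) = k.+1 /\ size (binary_chebyshev k.+1) = k.+2.
elim: k => [|k [IH1 IH2]]; first by rewrite size_poly1 size_polyX.
have pX : size ('X * binary_chebyshev k.+1) = k.+3.
  by rewrite mulrC size_mulX ?IH2 // -size_poly_eq0 IH2.
by split=> //; rewrite binary_chebyshevSS size_polyDl pX // IH1.
Qed.

Lemma comp_shiftK (p : {poly 'F_2}) : (p \Po (1 + 'X)) \Po (1 + 'X) = p.
Proof.
by rewrite -comp_polyA comp_polyD comp_polyX rmorph1 addrA addrr_F2 add0r comp_polyXr.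
Qed.

(** Substituting [1 + 'X] is an involution in characteristic 2 and preserves coprimality. *)
Lemma coprimep_shift (p q : {poly 'F_2}) :
  coprimep (p \Po (1 + 'X)) q = coprimep p (q \Po (1 + 'X)).
Proof.
by apply/idP/idP=> /(coprimep_comp_poly (1 + 'X)); rewrite comp_shiftK.
Qed.

(** * The adjacency matrix of a path and its minimal polynomial *)

Definition nat_adjacent (i j : nat) : bool := (i.+1 == j) || (j.+1 == i).

Lemma nat_adjacent_natr (i j : nat) :
  (nat_adjacent i j)%:R = (i.+1 == j)%:R + (j.+1 == i)%:R :> 'F_2.
Proof.
rewrite /nat_adjacent; case: eqP => [<-|_] /=; last by rewrite add0r.
by rewrite (_ : (_ == _) = false) ?addr0 //; apply/eqP; lia.
Qed.

(** As [f] lives on [nat] and vanishes from [m] on, an index [k] past the end is harmless; this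
    absorbs the upper boundary of the path. *)
Lemma sum_ord_delta (V : lmodType 'F_2) (m k : nat) (f : nat -> V) :
  (forall j, (m <= j)%N -> f j = 0) ->
  \sum_(j < m) (k == j)%:R *: f j = f k.
Proof.
move=> f0; case: (ltnP k m) => [km|mk].
  rewrite (bigD1 (Ordinal km)) //= eqxx scale1r big1 ?addr0 // => j /eqP jk.
  by case: eqP => [kj|]; rewrite ?scale0r //; case: jk; apply: val_inj.
rewrite f0 // big1 // => j _.
by case: eqP => [kj|]; rewrite ?scale0r //; move: (ltn_ord j); rewrite -kj ltnNge mk.
Qed.

Lemma sum_nat_adjacent (V : lmodType 'F_2) (m k : nat) (f : nat -> V) :
  (k < m)%N -> (forall j, (m <= j)%N -> f j = 0) ->
  \sum_(j < m) (nat_adjacent k j)%:R *: f j =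
    f k.+1 + (if k is k'.+1 then f k' else 0).
Proof.
move=> km f0.
under eq_bigr => j _ do rewrite nat_adjacent_natr scalerDl.
rewrite big_split /= sum_ord_delta //; congr (_ + _).
case: k km => [|k] km; first by rewrite big1 // => j _; rewrite scale0r.
under eq_bigr => j _ do rewrite eqSS eq_sym.
by rewrite sum_ord_delta.
Qed.

Definition path_mx (n : nat) : 'M['F_2]_n := \matrix_(i, j) (nat_adjacent i j)%:R.

(** Unit row vectors, indexed by [nat] so that the recurrence along the path can run off its end,
    where they are 0. *)
Definition nat_delta (n i : nat) : 'rV['F_2]_n := \row_l (i == l)%:R.

Lemma nat_delta_ge (n i : nat) : (n <= i)%N -> nat_delta n i = 0.
Proof.
move=> ni; apply/rowP=> l; rewrite !mxE; case: eqP => // il.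
by move: (ltn_ord l); rewrite -il ltnNge ni.
Qed.

Lemma sum_nat_delta (n : nat) (v : 'rV['F_2]_n) :
  v = \sum_(j < n) v 0 j *: nat_delta n j.
Proof.
apply/rowP=> l; rewrite summxE (bigD1 l) //= !mxE eqxx mulr1 big1 ?addr0 //.
move=> j jl; rewrite !mxE; case: eqP => [/val_inj jl'|]; last by rewrite mulr0.
by rewrite jl' eqxx in jl.
Qed.

Lemma nat_delta_path_mx (n k : nat) : (k < n)%N ->
  nat_delta n k *m path_mx n =
    nat_delta n k.+1 + (if k is k'.+1 then nat_delta n k' else 0).
Proof.
move=> kn; rewrite -(sum_nat_adjacent kn (@nat_delta_ge n)).
rewrite [LHS]sum_nat_delta; apply: eq_bigr => j _; congr (_ *: _).
rewrite mxE (bigD1 (Ordinal kn)) //= !mxE eqxx mul1r big1 ?addr0 //.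
move=> l /eqP lk; rewrite !mxE; case: eqP => [kl|]; rewrite ?mul0r //.
by case: lk; apply: val_inj.
Qed.

Section PathMatrix.
Variable n : nat.
Local Notation P := (path_mx n.+1).

(** With [e_k] the unit rows, [e_k P = e_(k+1) + e_(k-1)] is the Chebyshev recurrence modulo 2. The
    bound includes [k = n.+1], where the value is 0. *)
Lemma nat_delta_chebyshev (k : nat) : (k <= n.+1)%N ->
  nat_delta n.+1 0 *m horner_mx P (binary_chebyshev k) = nat_delta n.+1 k.
Proof.
suff H j : (j <= n)%N ->
    nat_delta n.+1 0 *m horner_mx P (binary_chebyshev j) = nat_delta n.+1 j /\
    nat_delta n.+1 0 *m horner_mx P (binary_chebyshev j.+1) = nat_delta n.+1 j.+1.
  by case: k => [|k] kn; [have [] := H 0%N isT | have [] := H k kn].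
elim: j => [|j IH] jn.
  by rewrite rmorph1 mulmx1 horner_mx_X nat_delta_path_mx // addr0.
have [IH1 IH2] := IH (ltnW jn); split=> //.
rewrite binary_chebyshevSS mulrC rmorphD rmorphM /= horner_mx_X.
by rewrite mulmxDr mulmxA IH1 IH2 nat_delta_path_mx // -addrA addrr_F2 addr0.
Qed.

(** Row [i] is [e_0 p_i(P) p_(n+1)(P)]; polynomials in [P] commute, and
    [e_0 p_(n+1)(P) = e_(n+1) = 0]. *)
Lemma horner_path_chebyshev : horner_mx P (binary_chebyshev n.+1) = 0.
Proof.
apply/row_matrixP=> i; rewrite row0 rowE.
have -> : delta_mx 0 i = nat_delta n.+1 i.
  by apply/rowP=> l; rewrite !mxE eqxx eq_sym.
rewrite -nat_delta_chebyshev 1?ltnW // -mulmxA -[horner_mx _ _ *m _]rmorphM /=.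
by rewrite mulrC rmorphM mulmxA nat_delta_chebyshev // nat_delta_ge ?mul0mx.
Qed.

(** The entry counts, modulo 2, the walks of length [k] from 0 to [l]: none passes [k], and only the
    straight one reaches it. *)
Lemma nat_delta_path_exp (k : nat) : (k <= n)%N ->
  forall l : 'I_n.+1, (k <= l)%N -> (nat_delta n.+1 0 *m P ^+ k) 0 l = (k == l)%:R.
Proof.
elim: k => [|k IH] kn l kl; first by rewrite expr0 mulmx1 mxE.
have kn' : (k < n.+1)%N by apply: ltnW.
rewrite exprSr mulmxA mxE (bigD1 (Ordinal kn')) //= (IH (ltnW kn)) //= eqxx mul1r.
rewrite big1 ?addr0 => [|j /eqP jk].
  by rewrite mxE /nat_adjacent /= [l.+1 == k]gtn_eqF ?orbF // ltnS ltnW.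
have [jk'|kj] := ltnP j k; last first.
  rewrite (IH (ltnW kn)) //; case: (k =P j) => [kj'|]; rewrite ?mul0r //.
  by case: jk; apply: val_inj.
by rewrite [P j l]mxE (_ : nat_adjacent j l = false) ?mulr0 // /nat_adjacent; lia.
Qed.

(* The rows [e_0 P^k], [k <= n], are independent, since the last nonzero entry of [e_0 P^k] is
   a 1 in position [k]. *)
Lemma horner_path_neq0 (p : {poly 'F_2}) :
  p != 0 -> (size p <= n.+1)%N -> horner_mx P p != 0.
Proof.
rewrite -size_poly_gt0; case sp: (size p) => [//|d] _ dn.
apply/eqP => pP0.
have: (nat_delta n.+1 0 *m horner_mx P p) 0 (Ordinal dn) = lead_coef p.
  rewrite -{1}[p]coefK poly_def sp rmorph_sum /= mulmx_sumr summxE big_ord_recr /=.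
  rewrite big1 ?add0r => [|i _].
    rewrite horner_mxZ rmorphXn /= horner_mx_X -scalemxAr mxE.
    by rewrite nat_delta_path_exp // eqxx mulr1 lead_coefE sp.
  rewrite horner_mxZ rmorphXn /= horner_mx_X -scalemxAr mxE.
  have id := ltn_ord i.
  by rewrite nat_delta_path_exp ?(ltn_eqF id) ?mulr0 //=; lia.
rewrite pP0 mulmx0 mxE => /esym/eqP.
by rewrite lead_coef_eq0 -size_poly_eq0 sp.
Qed.

(** If coprime, a Bezout relation evaluated at [P] gives the inverse, since [p_(n+1)(P) = 0]. The
    converse uses that no nonzero polynomial of smaller degree kills [P]. *)
Lemma horner_path_unit (p : {poly 'F_2}) :
  (horner_mx P p \in unitmx) = coprimep p (binary_chebyshev n.+1).
Proof.
have q0 : binary_chebyshev n.+1 != 0 by rewrite -size_poly_eq0 size_binary_chebyshev.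
apply/idP/idP=> [pU|/Bezout_eq1_coprimepP [[u v] /= uv1]]; last first.
  have := congr1 (horner_mx P) uv1.
  rewrite rmorphD !rmorphM /= horner_path_chebyshev mulr0 addr0 rmorph1.
  by case/mulmx1_unit.
have p0 : p != 0.
  by apply: contraTneq pU => ->; rewrite rmorph0 unitmxE det0 unitr0.
(* A common factor yields [u * p = v * p_(n+1)] with [u] nonzero of degree at most [n]; cancelling
   the invertible [p(P)] leaves [u(P) = 0]. *)
apply/negPn/negP=> /(Bezout_coprimepPn p0 q0) [[u v] /=].
case/andP=> /andP [u0 un] _ uv; move: un; rewrite size_binary_chebyshev ltnS => un.
have := horner_path_neq0 _ un; rewrite -size_poly_gt0 => /(_ u0) /eqP; apply.
apply: (can_inj (mulmxK pU)); rewrite mul0mx -[_ *m _]rmorphM /= uv.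
by rewrite rmorphM /= horner_path_chebyshev mulr0.
Qed.
End PathMatrix.

(** * The matrix equation [path_mx m *m X = X *m Q] *)

Lemma row_path_mx_mul (m n i : nat) (X : 'M['F_2]_(m, n)) (x : nat -> 'rV_n)
    (im : (i < m)%N) :
  (forall j : 'I_m, x j = row j X) -> (forall j, (m <= j)%N -> x j = 0) ->
  row (Ordinal im) (path_mx m *m X) =
    x i.+1 + (if i is i'.+1 then x i' else 0).
Proof.
move=> xX x0; rewrite -(sum_nat_adjacent im x0) row_mul mulmx_sum_row.
by apply: eq_bigr => j _; rewrite !mxE xX.
Qed.

(* Row by row, [P_m X = X Q] says that [x_(i+1) + x_(i-1) = x_i Q] with [x_(-1) = x_m = 0],
   i.e., that [x_i = x_0 p_i(Q)] and [x_0 p_m(Q) = 0]. *)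
Lemma sylvester_path_chebyshev (m n : nat) (Q : 'M['F_2]_n.+1) :
  horner_mx Q (binary_chebyshev m.+1) \in unitmx <->
  (forall X : 'M_(m.+1, n.+1), path_mx m.+1 *m X = X *m Q -> X = 0).
Proof.
set p := horner_mx Q (binary_chebyshev m.+1).
split=> [pU X PX|XP].
  (* The rows of [X] are continued by 0, which encodes the boundary condition after the last row. *)
  pose x i := if insub i is Some j then row j X else 0.
  have xX (j : 'I_m.+1) : x j = row j X by rewrite /x valK.
  have x0 j : (m < j)%N -> x j = 0 by move=> mj; rewrite /x insubN // -leqNgt.
  have xS i : (i <= m)%N -> x i.+1 + (if i is i'.+1 then x i' else 0) = x i *m Q.
    by move=> im; rewrite -(row_path_mx_mul (im : (i < m.+1)%N) xX x0) PX row_mul -xX.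
  have xE i : (i <= m)%N -> x i = x 0%N *m horner_mx Q (binary_chebyshev i) /\
      x i.+1 = x 0%N *m horner_mx Q (binary_chebyshev i.+1).
    elim: i => [|i IH] im.
      by rewrite rmorph1 mulmx1 horner_mx_X -xS // addr0.
    have [IH1 IH2] := IH (ltnW im); split=> //.
    rewrite binary_chebyshevSS mulrC rmorphD rmorphM /= horner_mx_X.
    by rewrite mulmxDr mulmxA -IH1 -IH2 -xS // -addrA addrr_F2 addr0.
  have x00 : x 0%N = 0.
    have [//|_] := xE m; rewrite x0 // -/p => /esym xp.
    by apply: (can_inj (mulmxK pU)); rewrite xp mul0mx.
  apply/row_matrixP=> i; rewrite row0 -xX.
  by have [|-> _] := xE i; [rewrite -ltnS | rewrite x00 mul0mx].
rewrite unitmxE unitfE; apply/negP=> /det0P [y y0 yp].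
(* A nonzero [y] killed by [p] is the first row of a nonzero solution. *)
pose x i := if (i <= m)%N then y *m horner_mx Q (binary_chebyshev i) else 0.
have x0 j : (m < j)%N -> x j = 0 by rewrite /x ltnNge => /negPf ->.
pose X := \matrix_(i < m.+1) x i.
have xX (j : 'I_m.+1) : x j = row j X by rewrite rowK.
have/XP X0 : path_mx m.+1 *m X = X *m Q.
  apply/row_matrixP=> -[i im]; rewrite (row_path_mx_mul im xX x0).
  rewrite row_mul -xX /=.
  (* At [i = m] the default value 0 agrees with the formula because [y *m p = 0]. *)
  have -> : x i.+1 = y *m horner_mx Q (binary_chebyshev i.+1).
    rewrite /x; case: ifP => // /negbT; rewrite -ltnNge ltnS => mi.
    by rewrite (_ : i = m) ?yp //; lia.
  rewrite /x -ltnS im; case: i im => [|i] im.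
    by rewrite rmorph1 mulmx1 horner_mx_X addr0.
  rewrite -ltnS (ltnW im) binary_chebyshevSS mulrC rmorphD rmorphM /= horner_mx_X.
  by rewrite mulmxDr mulmxA -addrA addrr_F2 addr0.
by move: (xX 0); rewrite X0 row0 /x /= rmorph1 mulmx1 => y00; rewrite y00 eqxx in y0.
Qed.

Lemma horner_mx_comp (R : comNzRingType) (n : nat) (A : 'M[R]_n.+1) (p q : {poly R}) :
  horner_mx A (p \Po q) = horner_mx (horner_mx A q) p.
Proof.
elim/poly_ind: p => [|p c IH]; first by rewrite comp_poly0 !rmorph0.
by rewrite comp_polyD comp_polyM comp_polyX comp_polyC !rmorphD !rmorphM /=
  !horner_mx_C horner_mx_X IH.
Qed.

(** * The grid with loops as a Kronecker sum of paths *)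

Definition grid_rel (m n : nat) : rel ('I_m * 'I_n) :=
  fun u v => (u == v) || adjacent u v.

Lemma grid_rel_sym (m n : nat) : symmetric (@grid_rel m n).
Proof.
move=> u v; rewrite /grid_rel /adjacent eq_sym; congr (_ || (_ && _ || _ && _)).
all: by rewrite 1?eq_sym 1?orbC.
Qed.

(** A monomer is the degenerate pair [[set u; u]], given by the loop of [grid_rel] at [u]. *)
Lemma monomer_dimer_tilings_pair_blocks (m n : nat) :
  monomer_dimer_tilings m n =
    [set P | partition P [set: 'I_m * 'I_n] && pair_blocks (@grid_rel m n) P].
Proof.
apply/setP=> P; rewrite !inE; congr (_ && _); apply: eq_forallb => B.
congr (_ ==> _); apply/orP/existsP.
  case=> [/existsP [u /eqP ->]|/existsP [u /existsP [v /andP [uv /eqP ->]]]];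
    exists u; apply/existsP.
    by exists u; rewrite /grid_rel setUid !eqxx.
  by exists v; rewrite /grid_rel uv orbT eqxx.
case=> u /existsP [v /andP [/orP [/eqP <-|uv] /eqP ->]]; [left|right].
  by apply/existsP; exists u; rewrite setUid.
by apply/existsP; exists u; apply/existsP; exists v; rewrite uv eqxx.
Qed.

(** Paths have no loops, so the three cases exclude each other and the disjunction becomes a sum. *)
Lemma grid_rel_natr (m n : nat) (u v : 'I_m * 'I_n) :
  (grid_rel u v)%:R =
    (u.1 == v.1)%:R * (u.2 == v.2)%:R
    + (u.1 == v.1)%:R * path_mx n u.2 v.2
    + (u.2 == v.2)%:R * path_mx m u.1 v.1 :> 'F_2.
Proof.
case: u v => [i j] [k l]; rewrite !mxE /grid_rel /adjacent xpair_eqE /= -!/(nat_adjacent _ _).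
have irr p (x : 'I_p) : nat_adjacent x x = false by rewrite /nat_adjacent; lia.
case: (eqVneq i k) => [->|_]; case: (eqVneq j l) => [->|_];
  by rewrite ?irr ?mul1r ?mul0r ?addr0 ?add0r ?orbF.
Qed.

Lemma path_mx_sym (n : nat) (i j : 'I_n) : path_mx n i j = path_mx n j i.
Proof. by rewrite !mxE /nat_adjacent orbC. Qed.

(** Reading [f] as a matrix, the horizontal edges act by right multiplication and the vertical ones
    by left multiplication; the latter uses the symmetry of [path_mx m]. *)
Lemma sum_grid_rel (m n : nat) (f : 'I_m * 'I_n -> 'F_2) (v : 'I_m * 'I_n) :
  let X := \matrix_(i, j) f (i, j) in
  \sum_u f u * (grid_rel u v)%:R = (X + X *m path_mx n + path_mx m *m X) v.1 v.2.
Proof.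
move=> X; case: v => k l /=.
have pairE F : \sum_u F u = \sum_(i < m) \sum_(j < n) F (i, j) :> 'F_2.
  by rewrite pair_bigA; apply: eq_bigr => -[].
have deltaE (I : finType) (x : I) F : \sum_y F y * (y == x)%:R = F x :> 'F_2.
  by rewrite (bigD1 x) //= eqxx mulr1 big1 ?addr0 // => y /negPf ->; rewrite mulr0.
under eq_bigr => u _ do rewrite grid_rel_natr !mulrDr.
rewrite !big_split /= !mxE; congr (_ + _ + _).
- by rewrite -[RHS](deltaE _ (k, l)); apply: eq_bigr => -[i j] _; rewrite -natrM mulnb.
- rewrite pairE exchange_big /=; apply: eq_bigr => j _.
  under eq_bigr => i _ do rewrite mulrA /=.
  by rewrite -mulr_suml (deltaE _ _ (fun i => f (i, j))) [X _ _]mxE.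
- rewrite pairE; apply: eq_bigr => i _.
  under eq_bigr => j _ do rewrite mulrA /=.
  by rewrite -mulr_suml (deltaE _ _ (fun j => f (i, j))) path_mx_sym mulrC [X _ _]mxE.
Qed.

Lemma grid_kernel_sylvester (m n : nat) :
  (forall f : 'I_m * 'I_n -> 'F_2,
     (forall v, \sum_u f u * (grid_rel u v)%:R = 0) -> forall u, f u = 0) <->
  (forall X : 'M_(m, n), path_mx m *m X = X *m (1%:M + path_mx n) -> X = 0).
Proof.
have E (X : 'M['F_2]_(m, n)) : path_mx m *m X = X *m (1%:M + path_mx n) <->
    X + X *m path_mx n + path_mx m *m X = 0.
  rewrite mulmxDr mulmx1 addrC; split=> [->|/eqP]; first exact: addrr_F2.
  by rewrite addr_eq0 oppr_F2 => /eqP.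
split=> [H X /E X0|H f f0 [i j]].
  apply/matrixP=> i j; rewrite mxE; apply: (H (fun u => X u.1 u.2) _ (i, j)) => v.
  rewrite sum_grid_rel (_ : \matrix_(_, _) _ = X) ?X0 ?mxE //.
  by apply/matrixP=> ? ?; rewrite mxE.
suff /matrixP /(_ i j) : \matrix_(i, j) f (i, j) = 0 by rewrite !mxE.
by apply: H; apply/E/matrixP=> k l; have := f0 (k, l); rewrite sum_grid_rel => ->; rewrite mxE.
Qed.

Theorem corollary6p2 (m n : nat) (hm : (1 <= m)%N) (hn : (1 <= n)%N) :
  odd #|monomer_dimer_tilings m n| <->
  coprimep (binary_chebyshev m) (binary_chebyshev n \Po (1 + 'X)).
Proof.
case: m hm => // m _; case: n hn => // n _.
(* The shift moves to [p_m], so that coprimality with [p_n] becomes invertibility of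
   [p_m(1 + P_n)]. *)
rewrite -coprimep_shift -horner_path_unit horner_mx_comp.
rewrite rmorphD rmorph1 /= horner_mx_X.
rewrite monomer_dimer_tilings_pair_blocks odd_pair_partitions; last exact: grid_rel_sym.
apply: (iff_trans (iff_sym (rwP (det_rel_mx_neq0P _)))).
exact: (iff_trans (grid_kernel_sylvester _ _) (iff_sym (sylvester_path_chebyshev _ _))).
Qed.
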